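(* Let $1\le p<\infty$, $p\neq 2$. If $\psi\in\mathbb{A}$ and $\phi\in\mathbb{A}$ is hyperbolic, then the isometry $M_\psi U_\phi$ on $H^p$ is not Crownover.
   Context: $D$ is the open unit disc in $\mathbb{C}$, $\mathbb{T}$ the unit circle, $H^p$ the Hardy space of $D$ with its usual norm. $\mathbb{A}$ is the group (under composition) of holomorphic automorphisms of $D$, i.e. the maps $\phi(z)=\frac{\lambda(z-a)}{1-\overline{a}z}$ with $a\in D$, $|\lambda|=1$; $e(z)=z$. $\phi\in\mathbb{A}$ is hyperbolic if $\phi\neq e$ and $\phi$ has two distinct fixed points on $\mathbb{T}$. For $F\in H^\infty$, $M_F$ is multiplication by $F$ on $H^p$; $C_\phi f=f\circ\phi$. For $\phi(z)=\frac{\lambda(z-a)}{1-\overline{a}z}$ in $\mathbb{A}$ put $U_\phi=M_{(\overline{\lambda}\phi')^{1/p}}C_\phi$, where $\overline\lambda\phi'(z)=\frac{1-|a|^2}{(1-\overline a z)^2}$ and the $p$-th root is the principal branch $(re^{i\theta})^{1/p}=r^{1/p}e^{i\theta/p}$, $r>0$, $-\pi<\theta<\pi$. For $\phi,\psi\in\mathbb{A}$ the operator $M_\psi U_\phi$ is an isometry of $H^p$ whose range has codimension one. A codimension one isometry $S$ on $H^p$ is Crownover if $\bigcap_{n=1}^\infty S^nH^p=(0)$. *)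

(* Defs.v *)
From HB Require Import structures.
From mathcomp Require Import all_boot all_order all_algebra.
From mathcomp Require Import all_classical all_reals all_analysis.
From mathcomp Require Export complex.

Set Implicit Arguments.
Unset Strict Implicit.
Unset Printing Implicit Defensive.

Import Order.TTheory GRing.Theory Num.Theory.
Import numFieldNormedType.Exports.
Import Normc.

Local Open Scope classical_set_scope.
Local Open Scope complex_scope.
Local Open Scope ring_scope.

(* On [R[i]] the library norm [`|z|] and the order take values in [R[i]]
   (with [`|z|] on the real axis); [normc z : R] is the modulus as a real. *)

Definition disc {R : realType} : set R[i] := [set z | `|z| < 1].

Definition unit_circle {R : realType} : set R[i] := [set z | `|z| = 1].

Definition expi {R : realType} (t : R) : R[i] := cos t +i* sin t.

(* The cast to [R[i]^o] makes [R[i]] a normed space over itself, so the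
   derivative is the complex one. *)
Definition holomorphic_on {R : realType} (A : set R[i]) (f : R[i] -> R[i]) :=
  forall z, A z -> derivable (f : R[i]^o -> R[i]^o) z 1.

Definition circle_mean {R : realType} (p : R) (f : R[i] -> R[i]) (r : R)
    : \bar R :=
  (((2 * pi)^-1)%R%:E *
   \int[lebesgue_measure]_(t in `[0%R, (2 * pi)%R])
     (normc (f (r%:C%C * expi t)%R) `^ p)%:E)%E.

(* The value may be [+oo]. *)
Definition hardy_norm {R : realType} (p : R) (f : R[i] -> R[i]) : \bar R :=
  (ereal_sup [set circle_mean p f r | r in `]0%R, 1%R[] `^ p^-1)%E.

(* Functions on the disc are represented by total functions on [R[i]];
   values outside the disc are irrelevant. *)
Definition hardy_space {R : realType} (p : R) : set (R[i] -> R[i]) :=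
  [set f | holomorphic_on disc f /\ (hardy_norm p f < +oo)%E].

(* The automorphism z |-> lambda (z - a) / (1 - conj(a) z); the parameters
   a and lambda are determined by the map. *)
Record disc_aut (R : realType) := DiscAut {
  aut_a : R[i];
  aut_lambda : R[i];
  aut_a_disc : disc aut_a;
  aut_lambda_circle : unit_circle aut_lambda
}.

Definition aut_fun {R : realType} (phi : disc_aut R) : R[i] -> R[i] :=
  fun z => aut_lambda phi * (z - aut_a phi) / (1 - conjc (aut_a phi) * z).

Coercion aut_fun : disc_aut >-> Funclass.

Definition hyperbolic {R : realType} (phi : disc_aut R) : Prop :=
  ~ (forall z, disc z -> phi z = z) /\
  exists u v, [/\ unit_circle u, unit_circle v, u <> v, phi u = u & phi v = v].

(* The angle theta in ]-pi, pi[ with z = |z| e^{i theta}; it exists and is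
   unique for z outside the half-line ]-oo, 0]. *)
Definition principal_arg {R : realType} (z : R[i]) : R :=
  xget 0 [set theta | - pi < theta < pi /\ z = (normc z)%:C * expi theta].

Definition principal_root {R : realType} (p : R) (z : R[i]) : R[i] :=
  (normc z `^ p^-1)%:C * expi (principal_arg z / p).

Definition mul_op {R : realType} (F f : R[i] -> R[i]) : R[i] -> R[i] :=
  fun z => F z * f z.

Definition comp_op {R : realType} (phi f : R[i] -> R[i]) : R[i] -> R[i] :=
  f \o phi.

Definition U_op {R : realType} (p : R) (phi : disc_aut R)
    (f : R[i] -> R[i]) : R[i] -> R[i] :=
  mul_op (fun z => principal_root p (conjc (aut_lambda phi) * 'D_1 (phi : R[i]^o -> R[i]^o) z))
         (comp_op phi f).

(* S^n H^p, as a set of functions up to their values outside the disc. *)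
Definition iter_range {R : realType} (p : R)
    (S : (R[i] -> R[i]) -> R[i] -> R[i]) (n : nat) : set (R[i] -> R[i]) :=
  [set f | exists2 g, hardy_space p g &
           forall z, disc z -> f z = iter n S g z].

Definition crownover {R : realType} (p : R)
    (S : (R[i] -> R[i]) -> R[i] -> R[i]) : Prop :=
  \bigcap_(n in [set n : nat | (1 <= n)%N]) iter_range p S n =
  [set f | forall z, disc z -> f z = 0].

(* Main.v *)
From HB Require Import structures.
Require Import Defs.
From mathcomp Require Import all_boot all_order all_algebra.
From mathcomp Require Import all_classical all_reals all_analysis.
From mathcomp Require Import ring lra.
Import Order.TTheory GRing.Theory Num.Theory.
Import numFieldNormedType.Exports.
Import Normc.
Set Implicit Arguments.
Unset Strict Implicit.
Unset Printing Implicit Defensive.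
Local Open Scope classical_set_scope.
Local Open Scope complex_scope.
Local Open Scope ring_scope.

(** Write S f = psi w (f o phi), where w = (conj(lambda) phi')^(1/p) is bounded,
zero-free and has a bounded inverse on the disc, and let b be the zero of psi. A
bounded holomorphic function belongs to S^n H^p as soon as it vanishes at the n points
phi^(-k)(b), k < n. When phi is hyperbolic the backward orbit of b converges
geometrically to a fixed point on the circle, so it satisfies the Blaschke
condition, and the Blaschke product B with zeros phi^(-k)(b), k >= 0, is a nonzero
element of every S^n H^p.

The product is built in the coordinate X(z) = (z - v) / (z - u), where u and v are
the fixed points of phi: there phi is multiplication by a constant q
([hyperbolic_coordinate]), with |q| < 1 once u and v are suitably ordered. The
entire function e(x) = prod_k (1 - q^k x) satisfies e(0) = 1 and
e(x) = (1 - x) e(q x) ([qpochhammer_exists]). With b' = 1 / conj(b) the reflection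
of b in the circle, put

  B(z) = e(X(z) / X(b)) / e(X(z) / X(b')).

The functional equation of e gives B = c psi (B o phi), where c is unimodular because
(1 - X/X(b)) / (1 - X/X(b')) is a unimodular multiple of psi. Everything else follows
from these two identities: |B(z)| <= |B(phi^n z)|, and the right-hand side tends to 1
since X(phi^n z) = q^n X(z) tends to 0, so B is bounded and not identically zero
([blaschke_hyperbolic]).

Finally the class of all B u with u bounded and holomorphic is contained in its own
image under S: B u = S (B u') for u' = (c u / w) o phi^(-1). By induction it is
contained in S^n H^p for every n ([iter_range_multiple]). This needs w to be
holomorphic, and so the principal root is expressed through a holomorphic logarithm
on the right half-plane, which contains 1 - conj(a) z ([principal_root_div_sqr]). *)

(** * The modulus as a real number *)
Section Modulus.
Variable R : realType.
Local Notation C := R[i].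

Lemma norm_normc (z : C) : `|z| = (normc z)%:C. Proof. by []. Qed.

Lemma normc_ge0 (z : C) : 0 <= normc z.
Proof. rewrite -lecR -norm_normc; exact: (normr_ge0 (z : C)). Qed.

Lemma normc_gt0 (z : C) : (0 < normc z) = (z != 0).
Proof. rewrite -ltcR -norm_normc; exact: (normr_gt0 (z : C)). Qed.

Lemma normcB (z w : C) : normc (z - w) = normc (w - z).
Proof. by rewrite -opprB normcN. Qed.

Lemma normc_sqr (z : C) : normc z ^+ 2 = complex.Re z ^+ 2 + complex.Im z ^+ 2.
Proof. by case: z => x y; rewrite /= sqr_sqrtr ?addr_ge0 ?sqr_ge0. Qed.

Lemma Re_le_normc (z : C) : `|complex.Re z| <= normc z.
Proof. by rewrite -lecR -norm_normc; exact: normc_ge_Re. Qed.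

Lemma Im_le_normc (z : C) : `|complex.Im z| <= normc z.
Proof.
rewrite -(ler_pXn2r (ltn0Sn 1)) ?nnegrE ?normc_ge0//.
by rewrite normc_sqr -[X in X <= _]normrX ger0_norm ?sqr_ge0// lerDr sqr_ge0.
Qed.

Lemma normc_le_ReIm (z : C) : normc z <= `|complex.Re z| + `|complex.Im z|.
Proof.
rewrite -(ler_pXn2r (ltn0Sn 1)) ?nnegrE ?normc_ge0 ?addr_ge0//.
rewrite normc_sqr sqrrD !real_normK ?num_real//.
by rewrite lerD2r lerDl mulrn_wge0// mulr_ge0.
Qed.

Lemma normc_real (x : R) : normc x%:C = `|x|.
Proof. by rewrite /= expr0n /= addr0 sqrtr_sqr. Qed.

Lemma normcX (z : C) n : normc (z ^+ n) = normc z ^+ n.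
Proof. by elim: n => [|n IH]; rewrite ?normc1// !exprS normcM IH. Qed.

End Modulus.

(** * Complex differentiability *)
Section ComplexDerivative.
Variable R : realType.
Local Notation C := R[i].

Definition holo (f : C -> C) (z : C) := derivable (f : C^o -> C^o) z 1.

Lemma holo_continuous (f : C -> C) (z : C) : holo f z -> forall e : R, 0 < e ->
  exists2 d : R, 0 < d & forall y, normc (y - z) < d -> normc (f y - f z) < e.
Proof.
move=> /derivable1_diffP /differentiable_continuous /cvgrPdist_lt H e e0.
have : (0 < e%:C :> C) by rewrite ltcR.
move=> /H /nbhs_ballP[[d d'] /= d0 Hd].
have dd : d' = 0 by move: d0; rewrite ltcE /= => /andP[/eqP].
subst d'; exists d => [|y yd]; first by move: d0; rewrite ltcR.
have /Hd /= : ball (z : C^o) (d%:C) y by rewrite -ball_normE /= distrC ltcR.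
by rewrite distrC ltcR.
Qed.

(** Every derivative that is computed from scratch below (the exponential, the
logarithm, the infinite product) comes from an explicit quadratic remainder, a form
that also survives pointwise limits. *)
Lemma is_derive_quadratic (f : C -> C) (z d: C) (K r : R) : 0 < r ->
  (forall h, normc h < r -> normc (f (z + h) - f z - d * h) <= K * normc h ^+ 2) ->
   is_derive (z : C^o) 1 (f : C^o -> C^o) d.
Proof.
move=> r0 H.
have HH : (fun h : C^o =>
    h^-1 *: ((f : C^o -> C^o) (h *: (1 : C^o) + z) - (f : C^o -> C^o) z)) @ 0^' --> (d : C^o).
  apply/cvgrPdist_le => /= eps eps0.
  have /andP[/eqP e1 e0] : (complex.Im eps == 0) && (0 < complex.Re eps).
    by move: eps0; rewrite ltcE.
  have -> : eps = (complex.Re eps)%:C by rewrite {1}(complexE eps) e1 rmorph0 mulr0 addr0.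
  exists (Num.min r (complex.Re eps / (`|K| + 1)))%:C.
    by rewrite /= ltcR lt_min r0 divr_gt0// ltr_wpDl.
  move=> h /=; rewrite sub0r normrN ltcR lt_min => /andP[hr hK] h0.
  rewrite /GRing.scale /= mulr1 distrC.
  have nh : 0 < normc h by rewrite -ltcR; exact: (etrans (normr_gt0 (h : C)) h0).
  have -> : h^-1 * (f (h + z) - f z) - d = h^-1 * (f (z + h) - f z - d * h).
    by rewrite (addrC h z); field.
  rewrite lecR normcM normcV ler_pdivrMl//; apply: (le_trans (H _ hr)).
  rewrite expr2 mulrCA ler_wpM2l ?(ltW nh)//.
  apply: (@le_trans _ _ ((`|K| + 1) * normc h)).
    by rewrite ler_wpM2r ?(ltW nh)// (le_trans (ler_norm K))// lerDl.
  by rewrite -ler_pdivlMl ?ltr_wpDl// mulrC ltW.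
apply: DeriveDef; first by apply/cvg_ex; exists d.
exact: cvg_lim HH.
Qed.

Lemma holo_cst (c z : C) : holo (fun=> c) z.
Proof. exact: derivable_cst. Qed.

Lemma holo_id (z : C) : holo id z.
Proof. exact: derivable_id. Qed.

Lemma holoB (f g : C -> C) z : holo f z -> holo g z -> holo (fun x => f x - g x) z.
Proof. exact: derivableB. Qed.

Lemma holoM (f g : C -> C) z : holo f z -> holo g z -> holo (fun x => f x * g x) z.
Proof. exact: derivableM. Qed.

Lemma holoV (f : C -> C) z : f z != 0 -> holo f z -> holo (fun x => (f x)^-1) z.
Proof. exact: derivableV. Qed.

Lemma holo_comp (f g : C -> C) z : holo f z -> holo g (f z) -> holo (fun x => g (f x)) z.
Proof.
move=> /derivable1_diffP df /derivable1_diffP dg.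
by apply/derivable1_diffP; exact: (differentiable_comp df dg).
Qed.

End ComplexDerivative.

(** * Complex exponential, and logarithm on the right half-plane *)
Section ExpLog.
Variable R : realType.
Local Notation C := R[i].

Lemma expiD (s t : R) : expi (s + t) = expi s * expi t.
Proof.
rewrite /expi cosD sinD; apply/eqP.
by rewrite eq_complex /= addrC [_ * cos t + _]addrC !eqxx.
Qed.

Lemma normc_expi (t : R) : normc (expi t) = 1.
Proof. by rewrite /= cos2Dsin2 sqrtr1. Qed.

Definition cexp (z : C) : C := (expR (complex.Re z))%:C * expi (complex.Im z).

Lemma cexpD z w : cexp (z + w) = cexp z * cexp w.
Proof. by case: z w => [a b] [c d]; rewrite /cexp /= expRD expiD rmorphM /=; ring. Qed.

Lemma normc_cexp z : normc (cexp z) = expR (complex.Re z).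
Proof. by rewrite normcM normc_expi mulr1 normc_real ger0_norm ?expR_ge0. Qed.

Lemma cexp_neq0 z : cexp z != 0.
Proof. by rewrite -normc_gt0 normc_cexp expR_gt0. Qed.

(** Bounds the Taylor remainders of sin and cos at 0 by integrating the bound, of one
order less, on the remainders of their derivatives. *)
Lemma MVT_bound (f df : R -> R) (K y : R) :
  (forall x : R, is_derive x 1 f (df x)) ->
  (forall x, `|x| <= `|y| -> `|df x| <= K) -> `|f y - f 0| <= K * `|y|.
Proof.
move=> fdf bd.
have cf a b : {within `[a, b], continuous f}.
  apply: derivable_within_continuous => x _.
  by have [] := fdf x.
have [y0|/ltW y0] := leP 0 y.
  have [c /[!in_itv]/= /andP[c0 cy] ->] := MVT_segment y0 (fun x _ => fdf x) (cf _ _).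
  rewrite subr0 normrM ler_wpM2r// bd// !ger0_norm//.
have [c /[!in_itv]/= /andP[cy c0] fE] := MVT_segment y0 (fun x _ => fdf x) (cf _ _).
rewrite distrC fE sub0r normrM normrN ler_wpM2r// bd// !ler0_norm// lerN2//.
Qed.

Lemma norm_sin_le (y : R) : `|sin y| <= `|y|.
Proof.
have := @MVT_bound sin cos 1 y _ _; rewrite sin0 subr0 mul1r; apply.
by move=> x _; rewrite ler_norml cos_geN1 cos_le1.
Qed.

Lemma cos_quad (y : R) : `|cos y - 1| <= `|y| ^+ 2.
Proof.
rewrite -cos0 expr2; apply: (@MVT_bound cos (fun x => - sin x)) => x xy.
by rewrite normrN (le_trans (norm_sin_le x)).
Qed.

Lemma sin_quad (y : R) : `|y| <= 1 -> `|sin y - y| <= `|y| ^+ 2.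
Proof.
move=> y1.
have /(_ _)/= := @MVT_bound (fun x => sin x - x) (fun x => cos x - 1) (`|y|) y.
rewrite sin0 !subr0 -expr2; apply => // x xy.
rewrite (le_trans (cos_quad x))// expr2 -[leRHS]mulr1.
by rewrite ler_pM// (le_trans xy).
Qed.

(** The upper bound is the inequality 1 - x <= exp(-x) multiplied by exp(x). *)
Lemma expR_quad (x : R) : `|x| <= 1/2 -> `|expR x - 1 - x| <= 2 * `|x| ^+ 2.
Proof.
rewrite ler_norml => /andP[xl xr].
have := expR_ge1Dx x; have := expR_ge1Dx (- x); have := expRxMexpNx_1 x.
have := expR_gt0 x.
rewrite real_normK ?num_real//.
set e := expR x; set e' := expR (- x) => e0 ee' h1 h2.
rewrite ger0_norm; last by lra.
have : e * (1 - x) <= 1 by rewrite -[leRHS]ee' ler_wpM2l// ltW.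
nra.
Qed.

(** By [cexpD] this estimate at the origin gives the derivative of the exponential
everywhere; it also controls the inverse function in [holo_clog]. *)
Lemma cexp_quad (h : C) : normc h <= 1/2 -> normc (cexp h - 1 - h) <= 8 * normc h ^+ 2.
Proof.
case: h => x y; move: (normc_ge0 (x +i* y)) (Re_le_normc (x +i* y)) (Im_le_normc (x +i* y)).
set h := x +i* y; set N := normc h => N0 xN yN N2.
have hx : `|x| <= 1/2 by exact: le_trans N2.
have hy : `|y| <= 1/2 by exact: le_trans N2.
have ex := expR_quad hx; have cy := cos_quad y.
have hy1 : `|y| <= 1 by lra.
have sy := sin_quad hy1.
have x2 : `|x| ^+ 2 <= N ^+ 2 by rewrite ler_pXn2r ?nnegrE.
have y2 : `|y| ^+ 2 <= N ^+ 2 by rewrite ler_pXn2r ?nnegrE.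
have xy : `|x| * `|y| <= N ^+ 2 by rewrite expr2 ler_pM.
have e2 : `|expR x| <= 2.
  rewrite ger0_norm ?expR_ge0//; move: ex hx; rewrite !ler_norml => /andP[_ +] /andP[_ +].
  have : `|x| ^+ 2 <= 1/4 by rewrite (_ : 1/4 = (1/2)^+2); [rewrite ler_pXn2r ?nnegrE//; lra|field].
  lra.
have e1 : `|expR x - 1| <= 2 * `|x|.
  have -> : expR x - 1 = (expR x - 1 - x) + x by ring.
  rewrite (le_trans (ler_normD _ _))//.
  have := normr_ge0 x; nra.
apply: (le_trans (normc_le_ReIm _)); rewrite /cexp [complex.Re (_ - _)]/= [complex.Im (_ - _)]/=.
have -> : expR x * cos y - 0 * sin y - 1 - x = expR x * (cos y - 1) + (expR x - 1 - x) by ring.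
have -> : expR x * sin y + 0 * cos y - 0 - y = expR x * (sin y - y) + (expR x - 1) * y by ring.
have a1 : `|expR x * (cos y - 1)| <= 2 * N ^+ 2.
  by rewrite normrM ler_pM// (le_trans cy).
have a2 : `|expR x * (sin y - y)| <= 2 * N ^+ 2.
  by rewrite normrM ler_pM// (le_trans sy).
have a3 : `|(expR x - 1) * y| <= 2 * N ^+ 2.
  by rewrite normrM (@le_trans _ _ (2 * `|x| * `|y|)) ?ler_wpM2r// -mulrA ler_wpM2l.
have b1 := ler_normD (expR x * (cos y - 1)) (expR x - 1 - x).
have b2 := ler_normD (expR x * (sin y - y)) ((expR x - 1) * y).
lra.
Qed.

Lemma holo_cexp (z : C) : holo cexp z.
Proof.
suff [] : is_derive (z : C^o) 1 (cexp : C^o -> C^o) (cexp z) by [].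
apply: (@is_derive_quadratic _ _ _ _ (8 * normc (cexp z)) (1/2)); first by lra.
move=> h /ltW hh.
have -> : cexp (z + h) - cexp z - cexp z * h = cexp z * (cexp h - 1 - h).
  by rewrite cexpD; ring.
by rewrite normcM [8 * _]mulrC -mulrA ler_wpM2l ?normc_ge0// cexp_quad.
Qed.

(** The principal logarithm, for numbers of positive real part only: there the
argument is an arctangent. *)
Definition clog (z : C) : C := ln (normc z) +i* atan (complex.Im z / complex.Re z).

Lemma cexp_clog z : 0 < complex.Re z -> cexp (clog z) = z.
Proof.
case: z => x y /= x0; rewrite /cexp /clog.
have n0 : 0 < normc (x +i* y) by rewrite normc_gt0 eq_complex /= gt_eqF.
rewrite -[X in expR X]/(ln (normc (x +i* y))) -[X in expi X]/(atan (y / x)) lnK ?posrE//.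
have nE : normc (x +i* y) = x * Num.sqrt (1 + (y / x) ^+ 2).
  rewrite /= -[in RHS](ger0_norm (ltW x0)) -sqrtr_sqr -sqrtrM ?sqr_ge0//.
  by congr Num.sqrt; rewrite sqrtr_sqr ger0_norm ?ltW//; field; rewrite gt_eqF.
have s0 : 0 < Num.sqrt (1 + (y / x) ^+ 2) by rewrite sqrtr_gt0 ltr_wpDr ?sqr_ge0.
have c0 : cos (atan (y / x)) = (Num.sqrt (1 + (y / x) ^+ 2))^-1 by exact: cos_atan.
have sE : sin (atan (y / x)) = y / x * (Num.sqrt (1 + (y / x) ^+ 2))^-1.
  rewrite -c0 -{2}(atanK (y / x)) /tan divfK// c0 invr_eq0 gt_eqF//.
rewrite nE /expi c0 sE; apply/eqP.
rewrite eq_complex [complex.Re (_ * _)]/= [complex.Im (_ * _)]/= !mul0r subr0 addr0 /=.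
by apply/andP; split; apply/eqP; field; rewrite ?gt_eqF.
Qed.

Lemma continuous_Re (z : C) : complex.Re x @[x --> (z : C^o)] --> complex.Re z.
Proof.
apply/cvgrPdist_lt; first exact: (@nbhs_filter C^o z).
move=> e e0; apply/(@nbhs_ballP C C^o).
exists e%:C => [|y]; rewrite /= ?ltcR// -ball_normE /= ltcR => yz.
by rewrite (le_lt_trans _ yz)// (le_trans _ (Re_le_normc _))// raddfB.
Qed.

Lemma continuous_Im (z : C) : complex.Im x @[x --> (z : C^o)] --> complex.Im z.
Proof.
apply/cvgrPdist_lt; first exact: (@nbhs_filter C^o z).
move=> e e0; apply/(@nbhs_ballP C C^o).
exists e%:C => [|y]; rewrite /= ?ltcR// -ball_normE /= ltcR => yz.
by rewrite (le_lt_trans _ yz)// (le_trans _ (Im_le_normc _))// raddfB.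
Qed.

Lemma normc_dist (z w : C) : `|normc z - normc w| <= normc (z - w).
Proof.
have := le_normcD (z - w) w; have := le_normcD (w - z) z.
rewrite !subrK [normc (w - z)]normcB ler_norml => a b; lra.
Qed.

Lemma continuous_normc (z : C) : normc x @[x --> (z : C^o)] --> normc z.
Proof.
apply/cvgrPdist_lt; first exact: (@nbhs_filter C^o z).
move=> e e0; apply/(@nbhs_ballP C C^o).
exists e%:C => [|y]; rewrite /= ?ltcR// -ball_normE /= ltcR => yz.
by rewrite (le_lt_trans _ yz)// normc_dist.
Qed.

Lemma continuous_clog (z : C) : 0 < complex.Re z ->
  forall e : R, 0 < e ->
  exists2 d : R, 0 < d & forall h, normc h < d -> normc (clog (z + h) - clog z) < e.
Proof.
move=> z0 e e0.
have n0 : 0 < normc z by rewrite (lt_le_trans z0)// (le_trans _ (Re_le_normc _))// ler_norm.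
have lnz : (fun x : C^o => ln (normc x)) @ (z : C^o) --> ln (normc z).
  apply: (@cvg_comp C^o R R (fun x : C^o => normc x) (@ln R)
    (nbhs (z : C^o)) (nbhs (normc z)) (nbhs (ln (normc z)))).
    exact: continuous_normc.
  exact: continuous_ln.
have atz : (fun x : C^o => atan (complex.Im x / complex.Re x)) @ (z : C^o) -->
    atan (complex.Im z / complex.Re z).
  apply: (@cvg_comp C^o R R (fun x : C^o => complex.Im x / complex.Re x) (@atan R)
    (nbhs (z : C^o)) (nbhs (complex.Im z / complex.Re z))
    (nbhs (atan (complex.Im z / complex.Re z)))); last exact: continuous_atan.
  apply: cvgM; first exact: continuous_Im.
  by apply: cvgV; [rewrite gt_eqF|exact: continuous_Re].
have e2 : 0 < e / 2 by rewrite divr_gt0.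
move/cvgrPdist_lt : lnz => /(_ _ e2) /nbhs_ballP[[d1 d1'] /=].
rewrite ltcE /= => /andP[/eqP -> d10] H1.
move/cvgrPdist_lt : atz => /(_ _ e2) /nbhs_ballP[[d2 d2'] /=].
rewrite ltcE /= => /andP[/eqP -> d20] H2.
exists (Num.min d1 d2); first by rewrite lt_min d10.
move=> h; rewrite lt_min => /andP[h1 h2].
have b1 : ball (z : C^o) (d1%:C) (z + h).
  by rewrite -ball_normE /= ltcR normcB addrC addKr.
have b2 : ball (z : C^o) (d2%:C) (z + h).
  by rewrite -ball_normE /= ltcR normcB addrC addKr.
apply: (le_lt_trans (normc_le_ReIm (clog (z + h) - clog z))); rewrite [e]splitr ltrD//.
  by rewrite distrC; exact: H1.
by rewrite distrC; exact: H2.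
Qed.

(** Inverse function argument: k = clog (z + h) - clog z is small by continuity and
satisfies exp k - 1 = h / z, so [cexp_quad] first bounds k by 2 |h / z| and then
k - h / z quadratically. *)
Lemma holo_clog (z : C) : 0 < complex.Re z -> holo clog z.
Proof.
move=> z0.
have zn0 : z != 0 by apply: contraTneq z0 => ->; rewrite ltxx.
suff [] : is_derive (z : C^o) 1 (clog : C^o -> C^o) z^-1 by [].
(* for |k| <= 1/16 the remainder 8 |k|^2 is at most |k| / 2 *)
have e16 : 0 < (1/16 : R) by lra.
have [d d0 Hd] := continuous_clog z0 e16.
(* |h| < Re z keeps z + h in the right half-plane *)
have zd : 0 < Num.min d (complex.Re z) by rewrite lt_min d0.
apply: (@is_derive_quadratic _ _ _ _ (32 * normc z^-1 ^+ 2) _ zd) => h.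
rewrite lt_min => /andP[hd hz].
have zh0 : 0 < complex.Re (z + h).
  have := Re_le_normc h; rewrite ler_norml raddfD /=; lra.
have := Hd _ hd; set k := clog (z + h) - clog z => k16.
have kE : z^-1 * h = cexp k - 1.
  have : cexp k * cexp (clog z) = cexp (clog (z + h)) by rewrite -cexpD subrK.
  by rewrite !cexp_clog// => /(canRL (mulfK zn0)) ->; field.
have kq : normc (cexp k - 1 - k) <= 8 * normc k ^+ 2 by apply: cexp_quad; lra.
have kz : normc k <= normc (z^-1 * h) + normc (cexp k - 1 - k).
  have := le_normcD (z^-1 * h) (- (cexp k - 1 - k)).
  by rewrite normcN [X in normc X <= _](_ : _ = k)//; rewrite kE; ring.
have kk : normc k <= 2 * normc (z^-1 * h).
  have := normc_ge0 k; nra.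
have -> : k - z^-1 * h = - (cexp k - 1 - k) by rewrite kE; ring.
rewrite normcN (le_trans kq)// -mulrA -exprMn -normcM.
have : normc k ^+ 2 <= (2 * normc (z^-1 * h)) ^+ 2.
  by rewrite ler_pXn2r ?nnegrE ?mulr_ge0 ?normc_ge0.
rewrite exprMn; lra.
Qed.

End ExpLog.

(** * The entire function with zeros q^(-k) *)
Section Entire.
Variable R : realType.
Local Notation C := R[i].

Lemma geometric_small (M r e : R) : 0 <= r < 1 -> 0 < e -> exists n, M * r ^+ n < e.
Proof.
move=> /andP[r0 r1] e0.
have : (fun n => M * r ^+ n) @ \oo --> M * 0.
  by apply: cvgMr; apply: cvg_expr; rewrite ger0_norm.
rewrite mulr0 => /cvgrPdist_lt /(_ _ e0) [n _ /(_ n (leqnn n))].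
rewrite /= sub0r normrN => h; exists n; exact: le_lt_trans (ler_norm _) h.
Qed.

(** With g n = K r^n / (1 - r), the intervals [a n - g n, a n + g n] are nested; the
limit is the supremum of their left ends. *)
Lemma geometric_cauchy_real (a : nat -> R) (K r : R) : 0 <= r < 1 ->
  (forall n, `|a n.+1 - a n| <= K * r ^+ n) ->
  exists l, forall n, `|a n - l| <= K / (1 - r) * r ^+ n.
Proof.
move=> /andP[r0 r1] aK.
have r1' : 1 - r != 0 by rewrite subr_eq0 gt_eqF.
pose g n := K / (1 - r) * r ^+ n.
have gS n : g n - g n.+1 = K * r ^+ n by rewrite /g exprS; field.
have K0 : 0 <= K by have := aK 0; rewrite expr0 mulr1; exact: le_trans.
have g0 n : 0 <= g n by rewrite mulr_ge0 ?divr_ge0 ?subr_ge0 ?exprn_ge0// ltW.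
have inc m n : (m <= n)%N -> a m - g m <= a n - g n.
  move=> /subnK <-; elim: (n - m)%N => [|k IH]//; apply: (le_trans IH).
  by rewrite addSn; have := aK (k + m)%N; rewrite -gS ler_norml; lra.
have dec m n : (m <= n)%N -> a n + g n <= a m + g m.
  move=> /subnK <-; elim: (n - m)%N => [|k IH]//; apply: le_trans IH.
  by rewrite addSn; have := aK (k + m)%N; rewrite -gS ler_norml; lra.
have ub m n : a m - g m <= a n + g n.
  have := inc _ _ (leq_maxl m n); have := dec _ _ (leq_maxr m n); have := g0 (maxn m n).
  lra.
exists (sup (range (fun n => a n - g n))) => n.
have hs : has_sup (range (fun n => a n - g n)).
  by split; [exists (a 0%N - g 0%N); exists 0%N|exists (a 0%N + g 0%N) => _ [m _ <-]].
have h1 : a n - g n <= sup (range (fun n => a n - g n)).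
  by apply: ub_le_sup; [case: hs|exists n].
have h2 : sup (range (fun n => a n - g n)) <= a n + g n.
  by apply: ge_sup; [case: hs|move=> _ [m _ <-]].
by rewrite -/(g n) ler_norml; lra.
Qed.

Lemma geometric_cauchy (a : nat -> C) (K r : R) : 0 <= r < 1 ->
  (forall n, normc (a n.+1 - a n) <= K * r ^+ n) ->
  exists l, forall n, normc (a n - l) <= 2 * K / (1 - r) * r ^+ n.
Proof.
move=> r01 aK.
have [n|x xE] := @geometric_cauchy_real (fun n => complex.Re (a n)) K r r01.
  by apply: le_trans (aK n); rewrite -raddfB; exact: Re_le_normc.
have [n|y yE] := @geometric_cauchy_real (fun n => complex.Im (a n)) K r r01.
  by apply: le_trans (aK n); rewrite -raddfB; exact: Im_le_normc.
exists (x +i* y) => n; apply: (le_trans (normc_le_ReIm (a n - (x +i* y)))).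
rewrite !raddfB /=; have := xE n; have := yE n; lra.
Qed.

Variable q : C.
Hypothesis q1 : normc q < 1.

Fixpoint qprod n (x : C) : C :=
  if n is m.+1 then qprod m x * (1 - x * q ^+ m) else 1.

(** The derivative of [qprod n], through the product rule. *)
Fixpoint dqprod n (x : C) : C :=
  if n is m.+1 then dqprod m x * (1 - x * q ^+ m) - q ^+ m * qprod m x else 0.

Let r := normc q.
Let S n : R := \sum_(k < n) r ^+ k.

Let r0 : 0 <= r. Proof. exact: normc_ge0. Qed.
Let S0 n : 0 <= S n. Proof. by apply: sumr_ge0 => i _; rewrite exprn_ge0. Qed.
Let SS n : S n.+1 = S n + r ^+ n. Proof. exact: big_ord_recr. Qed.
Let Sle n : S n <= (1 - r)^-1.
Proof.
rewrite -[leRHS]mulr1 ler_pdivlMl ?subr_gt0//.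
have -> : (1 - r) * S n = 1 - r ^+ n.
  elim: n => [|n IH]; first by rewrite /S big_ord0 mulr0 subrr.
  by rewrite SS mulrDr IH exprS; ring.
by rewrite gerBl exprn_ge0.
Qed.

(** Bounds on the disc of radius B that are uniform in n. The majorant of the product is
M n = exp (B S n) with S n = 1 + r + ... + r^(n-1) <= 1 / (1 - r); it absorbs a factor
since M n (1 + B r^n) <= M n.+1. Each factor of the product that is differentiated
costs one more factor S n, whence the powers of S n in the estimates. *)
Section Bounds.
Variable B : R.
Hypothesis B0 : 0 <= B.
Let M n := expR (B * S n).

Let M0 n : 0 <= M n. Proof. exact: expR_ge0. Qed.
Let MS n : M n * (1 + B * r ^+ n) <= M n.+1.
Proof. by rewrite /M SS (mulrDr B) expRD ler_wpM2l ?expR_ge0// expR_ge1Dx. Qed.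
Let Mle n : M n <= M n.+1.
Proof. by rewrite ler_expR ler_wpM2l// SS lerDl exprn_ge0. Qed.

Let factor_le x n : normc x <= B -> normc (1 - x * q ^+ n) <= 1 + B * r ^+ n.
Proof.
move=> xB; apply: (le_trans (le_normcD _ _)).
by rewrite normc1 normcN normcM normcX lerD2l ler_wpM2r ?exprn_ge0.
Qed.

Lemma qprod_le n x : normc x <= B -> normc (qprod n x) <= M n.
Proof.
move=> xB; elim: n => [|n IH]; first by rewrite normc1 /M /S big_ord0 mulr0 expR0.
by rewrite /= normcM (le_trans _ (MS n))// ler_pM ?normc_ge0 ?factor_le.
Qed.

Lemma dqprod_le n x : normc x <= B -> normc (dqprod n x) <= S n * M n.
Proof.
move=> xB; elim: n => [|n IH]; first by rewrite normc0 mulr_ge0.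
rewrite /=; apply: (le_trans (le_normcD _ _)); rewrite normcN SS mulrDl lerD//.
  rewrite normcM; apply: (@le_trans _ _ (S n * M n * (1 + B * r ^+ n))).
    by rewrite ler_pM ?normc_ge0 ?factor_le.
  by rewrite -mulrA ler_wpM2l.
rewrite normcM normcX ler_pM ?exprn_ge0 ?normc_ge0//.
exact: le_trans (qprod_le _ xB) (Mle n).
Qed.

Lemma qprod_lipschitz n x h : normc x <= B -> normc (x + h) <= B ->
  normc (qprod n (x + h) - qprod n x) <= normc h * S n * M n.
Proof.
move=> xB yB; elim: n => [|n IH]; first by rewrite subrr normc0 !mulr_ge0 ?normc_ge0.
have -> : qprod n.+1 (x + h) - qprod n.+1 x =
    (qprod n (x + h) - qprod n x) * (1 - x * q ^+ n) - qprod n (x + h) * (h * q ^+ n).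
  by rewrite /=; ring.
apply: (le_trans (le_normcD _ _)).
rewrite normcN SS (mulrDr (normc h)) (mulrDl _ _ (M _)) lerD//.
  rewrite normcM; apply: (@le_trans _ _ (normc h * S n * M n * (1 + B * r ^+ n))).
    by rewrite ler_pM ?normc_ge0 ?factor_le.
  by rewrite -mulrA ler_wpM2l// mulr_ge0 ?normc_ge0.
rewrite normcM mulrC normcM normcX ler_pM ?mulr_ge0 ?exprn_ge0 ?normc_ge0//.
exact: le_trans (qprod_le _ yB) (Mle n).
Qed.

Lemma qprod_quad n x h : normc x <= B -> normc (x + h) <= B ->
  normc (qprod n (x + h) - qprod n x - dqprod n x * h) <= normc h ^+ 2 * S n ^+ 2 * M n.
Proof.
move=> xB yB; elim: n => [|n IH].
  rewrite (_ : _ - _ = 0); last by rewrite /=; ring.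
  by rewrite normc0 mulr_ge0// mulr_ge0 ?sqr_ge0.
have -> : qprod n.+1 (x + h) - qprod n.+1 x - dqprod n.+1 x * h =
    (qprod n (x + h) - qprod n x - dqprod n x * h) * (1 - x * q ^+ n)
     - (qprod n (x + h) - qprod n x) * (h * q ^+ n).
  by rewrite /=; ring.
apply: (le_trans (le_normcD _ _)); rewrite normcN.
apply: (@le_trans _ _
  (normc h ^+ 2 * S n ^+ 2 * M n.+1 + normc h ^+ 2 * (S n * r ^+ n) * M n.+1)).
  apply: lerD.
    rewrite normcM; apply: (@le_trans _ _ (normc h ^+ 2 * S n ^+ 2 * M n * (1 + B * r ^+ n))).
      by rewrite ler_pM ?normc_ge0 ?factor_le.
    by rewrite -mulrA ler_wpM2l// mulr_ge0 ?sqr_ge0.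
  rewrite normcM [normc (h * _)]normcM normcX.
  apply: (@le_trans _ _ (normc h * S n * M n * (normc h * r ^+ n))).
    by rewrite ler_wpM2r ?qprod_lipschitz// mulr_ge0 ?normc_ge0 ?exprn_ge0.
  have -> : normc h * S n * M n * (normc h * r ^+ n) =
    normc h ^+ 2 * (S n * r ^+ n) * M n by ring.
  by rewrite ler_wpM2l// mulr_ge0 ?sqr_ge0// mulr_ge0 ?exprn_ge0.
rewrite -mulrDl -mulrDr ler_wpM2r// ler_wpM2l ?sqr_ge0// SS sqrrD.
have := S0 n; have := exprn_ge0 n r0; nra.
Qed.

Lemma qprod_step n x : normc x <= B ->
  normc (qprod n.+1 x - qprod n x) <= (B * expR (B / (1 - r))) * r ^+ n.
Proof.
move=> xB; have -> : qprod n.+1 x - qprod n x = - (x * qprod n x * q ^+ n) by rewrite /=; ring.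
rewrite normcN 2!normcM normcX ler_wpM2r ?exprn_ge0// ler_pM ?normc_ge0//.
by rewrite (le_trans (qprod_le _ xB))// ler_expR ler_wpM2l.
Qed.

Lemma dqprod_step n x : normc x <= B ->
  normc (dqprod n.+1 x - dqprod n x) <=
    ((B / (1 - r) + 1) * expR (B / (1 - r))) * r ^+ n.
Proof.
move=> xB.
have -> : dqprod n.+1 x - dqprod n x = - ((x * dqprod n x + qprod n x) * q ^+ n).
  by rewrite /=; ring.
rewrite normcN normcM normcX ler_wpM2r ?exprn_ge0//.
have ME : M n <= expR (B / (1 - r)) by rewrite ler_expR ler_wpM2l.
rewrite (le_trans (le_normcD _ _))// mulrDl mul1r lerD ?(le_trans (qprod_le _ xB))//.
rewrite normcM -mulrA ler_pM ?normc_ge0// (le_trans (dqprod_le _ xB))//.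
by rewrite ler_pM.
Qed.

End Bounds.

Lemma qprodS n x : qprod n.+1 x = (1 - x) * qprod n (q * x).
Proof.
elim: n => [|n IH]; first by rewrite /= expr0 mulr1 mul1r mulr1.
have -> : qprod n.+2 x = qprod n.+1 x * (1 - x * q ^+ n.+1) by [].
by rewrite IH /= exprS; ring.
Qed.

Lemma le_geometric_limit (t A K : R) : (forall n, t <= A + K * r ^+ n) -> t <= A.
Proof.
move=> tA; apply/ler_addgt0Pr => e e0.
have [|n Ke] := @geometric_small K r e _ e0; first by rewrite r0.
by rewrite (le_trans (tA n))// lerD2l ltW.
Qed.

Lemma qprod_cvg x : exists l, exists K, forall n, normc (qprod n x - l) <= K * r ^+ n.
Proof.
have r01 : 0 <= r < 1 by rewrite r0.
have [l lE] := geometric_cauchy r01 (fun n => qprod_step (normc_ge0 x) n (lexx _)).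
by exists l; exists (2 * (normc x * expR (normc x / (1 - r))) / (1 - r)).
Qed.

Lemma dqprod_cvg x : exists l, exists K, forall n, normc (dqprod n x - l) <= K * r ^+ n.
Proof.
have r01 : 0 <= r < 1 by rewrite r0.
have [l lE] := geometric_cauchy r01 (fun n => dqprod_step (normc_ge0 x) n (lexx _)).
by exists l; exists (2 * ((normc x / (1 - r) + 1) * expR (normc x / (1 - r))) / (1 - r)).
Qed.

Lemma geometric_limit_unique (a : nat -> C) (l m : C) (K K' : R) :
  (forall n, normc (a n - l) <= K * r ^+ n) ->
  (forall n, normc (a n - m) <= K' * r ^+ n) -> l = m.
Proof.
move=> al am; apply/eqP; rewrite -subr_eq0; apply: contraT; rewrite -normc_gt0 => lm.
suff : normc (l - m) <= 0 by rewrite leNgt lm.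
apply: (@le_geometric_limit _ _ (K + K')) => n; rewrite add0r mulrDl.
have -> : l - m = - (a n - l) + (a n - m) by ring.
by rewrite (le_trans (le_normcD _ _))// normcN lerD.
Qed.

(** The partial products and their derivatives converge geometrically at each point,
and the quadratic remainder of [qprod_quad] is uniform in n, so it passes to the
limit. *)
Lemma qpochhammer_exists : exists e : C -> C,
  [/\ forall x, holo e x,
      forall x, e x = (1 - x) * e (q * x) & e 0 = 1].
Proof.
pose e x := projT1 (cid (qprod_cvg x)).
have eE x : exists K, forall n, normc (qprod n x - e x) <= K * r ^+ n.
  exact: projT2 (cid (qprod_cvg x)).
have r1 : 0 < 1 - r by rewrite subr_gt0.
exists e; split.
- move=> x; have [d [K' dE]] := dqprod_cvg x.
  suff [] : is_derive (x : C^o) 1 (e : C^o -> C^o) d by [].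
  pose B := normc x + 1; pose A := (1 - r)^-1 ^+ 2 * expR (B / (1 - r)).
  apply: (@is_derive_quadratic _ _ _ _ A 1) => // h h1.
  have xB : normc x <= B by rewrite lerDl.
  have xhB : normc (x + h) <= B by rewrite (le_trans (le_normcD _ _))// lerD2l ltW.
  have B0 : 0 <= B by rewrite (le_trans _ xB)// normc_ge0.
  have [K1 e1] := eE x; have [K2 e2] := eE (x + h).
  apply: (@le_geometric_limit _ _ (K2 + K1 + K' * normc h)) => n.
  have -> : e (x + h) - e x - d * h =
      (qprod n (x + h) - qprod n x - dqprod n x * h)
      + (- (qprod n (x + h) - e (x + h)) + (qprod n x - e x) + (dqprod n x - d) * h) by ring.
  apply: (le_trans (le_normcD _ _)); apply: lerD.
    apply: (le_trans (qprod_quad B0 n xB xhB)).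
    rewrite /A [leRHS]mulrC -mulrA ler_wpM2l ?sqr_ge0// ler_pM ?sqr_ge0 ?expR_ge0//.
      by rewrite ler_pXn2r ?nnegrE ?invr_ge0 ?(ltW r1).
    by rewrite ler_expR ler_wpM2l.
  apply: (le_trans (le_normcD _ _)); rewrite [leRHS]mulrDl; apply: lerD.
    by apply: (le_trans (le_normcD _ _)); rewrite mulrDl lerD// normcN.
  by rewrite normcM mulrAC ler_wpM2r ?normc_ge0.
- move=> x; have [K1 e1] := eE x; have [K2 e2] := eE (q * x).
  (* both sides are limits of the partial products with one factor more *)
  apply: (@geometric_limit_unique (fun n => qprod n.+1 x) _ _ (K1 * r) (normc (1 - x) * K2)) => n.
    by rewrite -mulrA -exprS.
  by rewrite qprodS -mulrBr normcM -mulrA ler_wpM2l ?normc_ge0.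
- have [K1 e1] := eE 0.
  apply: (@geometric_limit_unique (fun n => qprod n 0) _ _ K1 0) => n //.
  rewrite mul0r (_ : qprod n 0 = 1) ?subrr ?normc0//.
  by elim: n => //= n ->; rewrite mul0r subr0 mulr1.
Qed.

End Entire.

Section QPochhammer.
Variable R : realType.
Local Notation C := R[i].

Lemma eventually_close (e : C -> C) (q x : C) : normc q < 1 ->
  holo e 0 -> e 0 = 1 -> exists N, forall n, (N <= n)%N -> normc (e (q ^+ n * x) - 1) < 1/3.
Proof.
move=> q1 he e01; have e3 : 0 < (1/3 : R) by lra.
have [d d0 Hd] := holo_continuous he e3.
have q01 : 0 <= normc q < 1 by rewrite normc_ge0.
have [N HN] := @geometric_small R (normc x) (normc q) d q01 d0.
exists N => n Nn; rewrite -e01; apply: Hd; rewrite subr0 normcM normcX mulrC.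
apply: le_lt_trans HN; rewrite ler_wpM2l ?normc_ge0//.
by rewrite ler_wiXn2l ?normc_ge0 ?ltW.
Qed.

Lemma qpochhammer_iter (e : C -> C) (q x : C) n :
  (forall y, e y = (1 - y) * e (q * y)) -> e x = qprod q n x * e (q ^+ n * x).
Proof.
move=> eq; elim: n => [|n IH]; first by rewrite /= expr0 !mul1r.
by rewrite /= {1}IH eq exprS -[q * q ^+ n * x]mulrA [x * _]mulrC -!mulrA.
Qed.

(** The tolerance 1/3 makes the quotient of two such values at most 2 in modulus. *)
Lemma normc_close1 (y : C) : normc (y - 1) < 1/3 -> 2/3 <= normc y <= 4/3.
Proof.
move=> y1; have := le_normcD (y - 1) 1; have := le_normcD (- (y - 1)) y.
rewrite subrK normcN (_ : - (y - 1) + y = 1); last by ring.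
by rewrite normc1; lra.
Qed.

(** The functional equation writes e(x) as a finite product of nonzero factors times
e(q^n x), which is close to 1. *)
Lemma qpochhammer_neq0 (e : C -> C) (q x : C) : normc q < 1 -> holo e 0 -> e 0 = 1 ->
  (forall y, e y = (1 - y) * e (q * y)) -> (forall n, 1 - q ^+ n * x != 0) -> e x != 0.
Proof.
move=> q1 he e0 eq fx.
have [N /(_ N (leqnn N)) /normc_close1 /andP[h _]] := eventually_close x q1 he e0.
rewrite (qpochhammer_iter x N eq) mulf_neq0//; last by rewrite -normc_gt0; lra.
elim: N {h} => [|n IH]; first exact: oner_neq0.
by rewrite /= mulf_neq0// [x * _]mulrC.
Qed.

End QPochhammer.

(** * Automorphisms of the disc and their fixed points *)
Section Automorphisms.
Variable R : realType.
Local Notation C := R[i].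

Lemma discE (z : C) : disc z = (normc z < 1) :> Prop.
Proof. by rewrite /disc /= norm_normc ltcR. Qed.

Lemma unit_circleE (z : C) : unit_circle z <-> z * conjc z = 1.
Proof.
rewrite /unit_circle /= -sqr_normc; split=> [->|/eqP]; first by rewrite expr1n.
by rewrite sqrf_eq1 => /orP[/eqP//|/eqP h]; have := normr_ge0 z; rewrite h oppr_ge0 ler10.
Qed.

Lemma normc_unit_circle (z : C) : unit_circle z -> normc z = 1.
Proof. by rewrite /unit_circle /= norm_normc => -[]. Qed.

Lemma normc_conj (z : C) : normc (conjc z) = normc z.
Proof. by case: z => x y; rewrite /= sqrrN. Qed.

Lemma Re_one_sub_gt0 (a z : C) : normc a < 1 -> normc z <= 1 -> 0 < complex.Re (1 - conjc a * z).
Proof.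
move=> a1 z1; rewrite raddfB /= subr_gt0.
apply: (le_lt_trans (ler_norm _)); apply: (le_lt_trans (Re_le_normc (conjc a * z))).
rewrite normcM normc_conj; have := normc_ge0 a; have := normc_ge0 z; nra.
Qed.

Lemma Re_gt0_neq0 (z : C) : 0 < complex.Re z -> z != 0.
Proof. by apply: contraTneq => ->; rewrite ltxx. Qed.

Lemma one_sub_neq0 (a z : C) : normc a < 1 -> normc z <= 1 -> 1 - conjc a * z != 0.
Proof. by move=> a1 z1; rewrite Re_gt0_neq0// Re_one_sub_gt0. Qed.

(** Gives both that automorphisms preserve the disc and that they preserve the
circle. *)
Lemma moebius_identity (a z : C) :
  normc (1 - conjc a * z) ^+ 2 - normc (z - a) ^+ 2 = (1 - normc a ^+ 2) * (1 - normc z ^+ 2).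
Proof. by rewrite !normc_sqr; case: a z => [a1 a2] [z1 z2] /=; ring. Qed.

Definition affine (c d z : C) : C := c * z + d.

Lemma is_derive_affine (c d z : C) : is_derive (z : C^o) 1 (affine c d : C^o -> C^o) c.
Proof.
apply: (@is_derive_quadratic _ _ _ _ 0 1) => // h _.
rewrite (_ : _ - _ = 0); last by rewrite /affine; ring.
by rewrite normc0 mul0r.
Qed.

Section Automorphism.
Variable phi : disc_aut R.
Local Notation a := (aut_a phi).
Local Notation l := (aut_lambda phi).

Lemma aut_a_lt1 : normc a < 1.
Proof. by rewrite -discE; exact: aut_a_disc. Qed.

Lemma aut_lambda_unit : l * conjc l = 1.
Proof. by apply/unit_circleE; exact: aut_lambda_circle. Qed.

Lemma aut_lambda_neq0 : l != 0.
Proof. by apply: contra_eq_neq aut_lambda_unit => ->; rewrite mul0r eq_sym oner_eq0. Qed.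

Lemma aut_disc z : disc z -> disc (phi z).
Proof.
rewrite !discE => z1; have a1 := aut_a_lt1.
have d0 : 0 < normc (1 - conjc a * z) by rewrite normc_gt0 one_sub_neq0// ltW.
rewrite /aut_fun 2!normcM normcV (normc_unit_circle (aut_lambda_circle phi)) mul1r.
rewrite ltr_pdivrMr// mul1r -(ltr_pXn2r (ltn0Sn 1)) ?nnegrE ?normc_ge0//.
rewrite -subr_gt0 moebius_identity mulr_gt0// subr_gt0 expr_lt1 ?normc_ge0//.
Qed.

Lemma aut_holo z : disc z -> holo phi z.
Proof.
rewrite discE => z1; apply: holoM.
  by apply: holoM; [exact: holo_cst|apply: holoB; [exact: holo_id|exact: holo_cst]].
apply: holoV; first by rewrite one_sub_neq0 ?aut_a_lt1// ltW.
apply: holoB; first exact: holo_cst.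
by apply: holoM; [exact: holo_cst|exact: holo_id].
Qed.

Lemma aut_derive z : disc z ->
  'D_1 (phi : C^o -> C^o) z = l * (1 - a * conjc a) / (1 - conjc a * z) ^+ 2.
Proof.
rewrite discE => z1; have a1 := aut_a_lt1.
have d0 : 1 - conjc a * z != 0 by rewrite one_sub_neq0// ltW.
pose N := (affine l (- (l * a)) : C^o -> C^o); pose D := (affine (- conjc a) 1 : C^o -> C^o).
have [dN NE] : is_derive (z : C^o) 1 N l := is_derive_affine _ _ _.
have [dD DE] : is_derive (z : C^o) 1 D (- conjc a) := is_derive_affine _ _ _.
have Dz : D z = 1 - conjc a * z by rewrite /D /affine; ring.
have D0 : D z != 0 by rewrite Dz.
have -> : (phi : C^o -> C^o) = (N * (fun x => (D x)^-1))%R.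
  apply/funext => x; rewrite /aut_fun /N /D /affine -[RHS]/(_ * _).
  by congr (_ / _); ring.
rewrite (deriveM dN (derivableV D0 dD)) (deriveV D0 dD) NE DE Dz /N /affine.
rewrite /GRing.scale /=; field; exact: d0.
Qed.

(** The inverse has parameters -lambda a and conj(lambda). *)
Lemma aut_inv_exists : exists phi' : disc_aut R, forall z, disc z -> phi' (phi z) = z.
Proof.
have l0 := aut_lambda_neq0; have ll := aut_lambda_unit; have a1 := aut_a_lt1.
have l1 := normc_unit_circle (aut_lambda_circle phi).
have da : disc (- (l * a)) by rewrite discE normcN normcM l1 mul1r.
have dl : unit_circle (conjc l) by apply/unit_circleE; rewrite conjcK mulrC.
exists (DiscAut da dl) => z dz.
have d0 : 1 - conjc a * z != 0 by rewrite one_sub_neq0 ?aut_a_lt1// ltW// -discE.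
have aa : 1 - conjc a * a != 0 by rewrite one_sub_neq0 ?ltW.
rewrite /aut_fun /= rmorphN rmorphM /=.
have -> : conjc l = l^-1 by apply: (mulfI l0); rewrite ll divff.
field; apply/and3P; split=> //.
by rewrite (_ : _ - _ = 1 - conjc a * a)//; ring.
Qed.

Lemma aut_fixedE u : unit_circle u -> phi u = u -> l * (u - a) = u * (1 - conjc a * u).
Proof.
move=> /normc_unit_circle u1 fu; rewrite -{2}fu /aut_fun divfK//.
by rewrite one_sub_neq0 ?aut_a_lt1 ?u1.
Qed.

(** The difference phi z - phi u, with the derivative-like factor
lambda (1 - |a|^2) / ((1 - conj(a) z)(1 - conj(a) u)). Taking the quotient for two
fixed points cancels everything that depends on z except z - v and z - u. *)
Lemma aut_sub_fixed u z : unit_circle u -> phi u = u -> disc z ->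
  phi z - u = l * (1 - a * conjc a) * (z - u) / ((1 - conjc a * z) * (1 - conjc a * u)).
Proof.
move=> uu fu; rewrite discE => z1.
have dz : 1 - conjc a * z != 0 by rewrite one_sub_neq0 ?aut_a_lt1 ?ltW.
have du : 1 - conjc a * u != 0 by rewrite one_sub_neq0 ?aut_a_lt1 ?normc_unit_circle.
apply: (mulIf du); apply: (mulIf dz).
rewrite [LHS](_ : _ = l * (z - a) * (1 - conjc a * u)
                       - (u * (1 - conjc a * u)) * (1 - conjc a * z)).
  by rewrite -(aut_fixedE uu fu); field; rewrite ?dz ?du.
by rewrite /aut_fun; field; exact: dz.
Qed.

(** Fixed points on the circle have 1 - conj(a) u on a fixed real line through 0; this
is what makes the multiplier of a hyperbolic map real. *)
Lemma aut_fixed_conj u : unit_circle u -> phi u = u ->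
  1 - conjc a * u = l * conjc (1 - conjc a * u).
Proof.
move=> uu fu; have /unit_circleE cu := uu.
have u0 : u != 0 by apply: contra_eq_neq cu => ->; rewrite mul0r eq_sym oner_eq0.
apply: (mulfI u0); rewrite -(aut_fixedE uu fu) rmorphB rmorph1 rmorphM /= conjcK.
by transitivity (l * (u - a * (u * conjc u))); [rewrite cu mulr1|ring].
Qed.

Lemma disc_neq_circle (z u : C) : disc z -> unit_circle u -> z - u != 0.
Proof.
rewrite discE => z1 /normc_unit_circle u1; rewrite subr_eq0.
by apply: contraTneq z1 => ->; rewrite u1 ltxx.
Qed.

Lemma aut_multiplier u v z : unit_circle u -> phi u = u -> unit_circle v -> phi v = v ->
  disc z -> (phi z - v) / (phi z - u) =
     (1 - conjc a * u) / (1 - conjc a * v) * ((z - v) / (z - u)).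
Proof.
move=> uu fu vv fv dz.
have zu := disc_neq_circle dz uu.
have d0 : 1 - conjc a * z != 0 by rewrite one_sub_neq0 ?aut_a_lt1// ltW// -discE.
have du : 1 - conjc a * u != 0 by rewrite one_sub_neq0 ?aut_a_lt1 ?normc_unit_circle.
have dv : 1 - conjc a * v != 0 by rewrite one_sub_neq0 ?aut_a_lt1 ?normc_unit_circle.
have aa : 1 - a * conjc a != 0 by rewrite mulrC one_sub_neq0 ?aut_a_lt1 ?ltW ?aut_a_lt1.
have l0 := aut_lambda_neq0.
rewrite (aut_sub_fixed uu fu dz) (aut_sub_fixed vv fv dz); field.
by rewrite ?zu ?d0 ?du ?dv ?aa ?l0.
Qed.

(** Put s = 1 - conj(a) u and t = 1 - conj(a) v. By [aut_fixed_conj] they lie on one real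
line through 0, so |s| = |t| forces s = t or s = -t; both have positive real part, so
s = t, hence a = 0. Then s = 1 gives lambda = 1, and phi is the identity. *)
Lemma aut_multiplier_norm_neq1 u v : hyperbolic phi ->
  unit_circle u -> phi u = u -> unit_circle v -> phi v = v -> u <> v ->
  normc (1 - conjc a * u) != normc (1 - conjc a * v).
Proof.
move=> [not_id _] uu fu vv fv uv; apply/eqP => nuv.
have ru : 0 < complex.Re (1 - conjc a * u) by rewrite Re_one_sub_gt0 ?aut_a_lt1 ?normc_unit_circle.
have rv : 0 < complex.Re (1 - conjc a * v) by rewrite Re_one_sub_gt0 ?aut_a_lt1 ?normc_unit_circle.
have l0 := aut_lambda_neq0.
have su := aut_fixed_conj uu fu; have sv := aut_fixed_conj vv fv.
have st : 1 - conjc a * u = 1 - conjc a * v.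
  move: su sv nuv ru rv; set s := 1 - conjc a * u; set t := 1 - conjc a * v => su sv nuv ru rv.
  have : s ^+ 2 = t ^+ 2.
    by rewrite 2!expr2 {2}su {2}sv !mulrA ![_ * l]mulrC -!mulrA -!sqr_normc !norm_normc nuv.
  move/eqP; rewrite eqf_sqr => /orP[/eqP//|/eqP st].
  by move: ru; rewrite st raddfN /= oppr_gt0 => /(lt_trans rv); rewrite ltxx.
have /eqP : conjc a * (u - v) = 0.
  rewrite (_ : _ * _ = (1 - conjc a * v) - (1 - conjc a * u)); last by ring.
  by rewrite st subrr.
rewrite mulf_eq0 conjc_eq0 subr_eq0 => /orP[/eqP a0|/eqP//].
apply: not_id => z _; move: su; rewrite /aut_fun a0 conjc0 !mul0r subr0 conjc1 mulr1 => <-.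
by rewrite subr0 mul1r divr1.
Qed.

(** The fixed points are named so that v is attracting, whence |q| < 1; exchanging them
inverts q. *)
Lemma hyperbolic_coordinate : hyperbolic phi ->
  exists u v q, [/\ unit_circle u, unit_circle v, u != v, normc q < 1 &
    forall z, disc z -> (phi z - v) / (phi z - u) = q * ((z - v) / (z - u))].
Proof.
move=> hyp; have [_ [u [v [uu vv uv fu fv]]]] := hyp.
have du : 0 < normc (1 - conjc a * u).
  by rewrite normc_gt0 one_sub_neq0 ?aut_a_lt1 ?normc_unit_circle.
have dv : 0 < normc (1 - conjc a * v).
  by rewrite normc_gt0 one_sub_neq0 ?aut_a_lt1 ?normc_unit_circle.
have := aut_multiplier_norm_neq1 hyp uu fu vv fv uv.
rewrite neq_lt => /orP[h|h].
  exists u, v, ((1 - conjc a * u) / (1 - conjc a * v)); split=> //; first exact/eqP.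
    by rewrite normcM normcV ltr_pdivrMr// mul1r.
  by move=> z; exact: aut_multiplier.
exists v, u, ((1 - conjc a * v) / (1 - conjc a * u)); split=> //; first exact/eqP/nesym.
  by rewrite normcM normcV ltr_pdivrMr// mul1r.
by move=> z; exact: aut_multiplier.
Qed.

End Automorphism.

End Automorphisms.

(** * Principal roots through the logarithm *)
Section Weight.
Variable R : realType.
Local Notation C := R[i].

Lemma expi_inj (s t : R) : - pi < s < pi -> - pi < t < pi -> expi s = expi t -> s = t.
Proof.
move=> /andP[s1 s2] /andP[t1 t2] [cst sst].
have norm_lt (x : R) : - pi < x -> x < pi -> `|x| < pi by move=> a b; rewrite ltr_norml a.
have abs_itv (x : R) : - pi < x -> x < pi -> `|x| \in `[0, pi].
  by move=> a b; rewrite in_itv /= normr_ge0 ltW ?norm_lt.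
have cos_abs (x : R) : cos `|x| = cos x by case: ger0P => // _; rewrite cosN.
have /eqP : `|s| = `|t| by apply: cos_inj; rewrite ?abs_itv// !cos_abs.
rewrite eqr_norm2 => /orP[/eqP//|/eqP st].
have : sin `|t| = 0.
  have st0 : sin t = 0 by move: sst; rewrite st sinN; lra.
  by case: (ger0P t) => // _; rewrite sinN st0 oppr0.
have [t0|] := eqVneq t 0; first by rewrite st t0 oppr0.
rewrite -normr_gt0 => t0 /eqP; rewrite gt_eqF// sin_gt0_pi// t0 norm_lt//.
Qed.

(** The bound on Im y says that Im y is the principal argument of exp y. *)
Lemma principal_root_cexp (p : R) (y : C) : - pi < complex.Im y < pi ->
  principal_root p (cexp y) = cexp (y * (p^-1)%:C).
Proof.
move=> ypi; rewrite /principal_root normc_cexp.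
have -> : principal_arg (cexp y) = complex.Im y.
  rewrite /principal_arg; case: xgetP => [t _ [tpi]|/(_ (complex.Im y)) []]; last first.
    by rewrite normc_cexp.
  rewrite normc_cexp => /mulfI => h; apply: esym; apply: expi_inj => //; apply: h.
  by rewrite fmorph_eq0 gt_eqF// expR_gt0.
case: y {ypi} => a b; rewrite /cexp /= -expRM !mulr0 subr0 add0r.
by [].
Qed.

(** The logarithm of z has imaginary part in ]-pi/2, pi/2[, so ln k - 2 log z still has
imaginary part in ]-pi, pi[. *)
Lemma principal_root_div_sqr (p : R) (k : R) (z : C) : 0 < k -> 0 < complex.Re z ->
  principal_root p (k%:C / z ^+ 2) = cexp (((ln k)%:C - 2 * clog z) * (p^-1)%:C).
Proof.
move=> k0 z0; rewrite -principal_root_cexp; last first.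
  have -> : complex.Im ((ln k)%:C - 2 * clog z) = - 2 * atan (complex.Im z / complex.Re z).
    by rewrite /clog /=; ring.
  have := atan_gtNpi2 (complex.Im z / complex.Re z).
  have := atan_ltpi2 (complex.Im z / complex.Re z).
  lra.
congr principal_root.
have zn0 : z != 0 by apply: contraTneq z0 => ->; rewrite ltxx.
apply: (mulIf (cexp_neq0 (2 * clog z))); rewrite -cexpD subrK.
rewrite mulr_natl mulr2n cexpD cexp_clog// /cexp /= lnK ?posrE//.
rewrite /expi cos0 sin0 (_ : 1 +i* 0 = 1)// mulr1; field; exact: zn0.
Qed.

End Weight.

(** * Bounded holomorphic functions lie in every Hardy space *)
Section Hardy.
Variable R : realType.
Local Notation C := R[i].

(** Integrals of nonnegative functions are suprema over simple functions below them, so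
monotonicity holds without measurability. *)
Lemma ge0_le_integral_nonmeasurable d (T : measurableType d) (mu : measure T R) (D : set T)
    (f g : T -> \bar R) :
  (forall x, D x -> 0 <= f x)%E -> (forall x, D x -> f x <= g x)%E ->
  (\int[mu]_(x in D) f x <= \int[mu]_(x in D) g x)%E.
Proof.
move=> f0 fg; have g0 x : D x -> (0 <= g x)%E by move=> Dx; exact: le_trans (f0 _ Dx) (fg _ Dx).
rewrite ge0_integralE// [leRHS]ge0_integralE//; apply: le_ereal_sup => _ [h hf <-].
exists h => // x; apply: (le_trans (hf x)); rewrite /patch; case: ifPn => //.
by rewrite inE => /fg.
Qed.

Lemma bounded_hardy_space (p : R) (f : C -> C) (A : R) : 1 <= p ->
  holomorphic_on disc f -> (forall z, disc z -> normc (f z) <= A) ->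
  hardy_space p f.
Proof.
move=> p1 hf fA; split=> //; rewrite /hardy_norm.
apply: poweR_lty.
apply: (@le_lt_trans _ _ ((2 * pi)^-1%:E * ((A `^ p)%:E * (2 * pi)%:E))%E); last first.
  by rewrite -!EFinM ltry.
apply: ge_ereal_sup => _ [r rI <-].
move: rI; rewrite /= in_itv /= => /andP[r0 r1].
have pi0 : (0 <= 2 * pi :> R) by rewrite mulr_ge0// pi_ge0.
rewrite /circle_mean lee_wpmul2l ?lee_fin ?invr_ge0//.
apply: (@le_trans _ _ (\int[lebesgue_measure]_(t in `[0%R, (2 * pi)%R]) cst (A `^ p)%:E t)%E).
  apply: ge0_le_integral_nonmeasurable => t _; first by rewrite lee_fin powR_ge0.
  have dz : disc (r%:C * expi t).
    by rewrite /disc /= norm_normc ltcR normcM normc_expi mulr1 normc_real gtr0_norm.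
  have A0 := le_trans (normc_ge0 (f (r%:C * expi t))) (fA _ dz).
  by rewrite lee_fin; apply: ge0_ler_powR (fA _ dz); rewrite ?nnegrE ?normc_ge0// (le_trans ler01).
rewrite integral_cst//= lebesgue_measure_itv/= lte_fin.
case: ifPn => _; first by rewrite oppr0 adde0.
by rewrite mule0 mule_ge0// lee_fin// powR_ge0.
Qed.

End Hardy.

(** * A function lying in every range *)
Section Divisor.
Variable R : realType.
Local Notation C := R[i].

(** B is, up to a constant factor, the Blaschke product over the backward orbit of the
zero of psi. Its modulus is bounded by 1, but the bound 2 is enough and needs no limit:
|B(z)| <= |B(phi^n z)|, and for one large n numerator and denominator of the right-hand
side are within 1/3 of 1. *)
Lemma blaschke_hyperbolic (phi psi : disc_aut R) : hyperbolic phi ->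
  exists B c, [/\ forall z, disc z -> holo B z,
    forall z, disc z -> normc (B z) <= 2,
    forall z, disc z -> B z = c * psi z * B (phi z) &
    exists2 z, disc z & B z != 0].
Proof.
move=> hyp; have [u [v [q [uu vv uv q1 qE]]]] := hyperbolic_coordinate hyp.
have [e [he eq e0]] := qpochhammer_exists q1.
pose b := aut_a psi; have b1 : normc b < 1 by exact: aut_a_lt1.
have bd : disc b by exact: aut_a_disc.
have bu : b - u != 0 by exact: disc_neq_circle.
have bv : b - v != 0 by exact: disc_neq_circle.
have du : 1 - conjc b * u != 0 by rewrite one_sub_neq0// normc_unit_circle.
have dv : 1 - conjc b * v != 0 by rewrite one_sub_neq0// normc_unit_circle.
(* y1 = X / X(b) and y2 = X / X(1 / conj b); the second is written so that b = 0, where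
   the reflected point is infinite and X = 1, needs no special treatment *)
pose X z := (z - v) / (z - u).
pose y1 z := X z * ((b - u) / (b - v)).
pose y2 z := X z * ((1 - conjc b * u) / (1 - conjc b * v)).
have it_disc n z : disc z -> disc (iter n phi z).
  by move=> dz; elim: n => //= n; exact: aut_disc.
have it_X n z : disc z -> X (iter n phi z) = q ^+ n * X z.
  move=> dz; elim: n => [|n IH]; first by rewrite mul1r.
  by rewrite [LHS](qE _ (it_disc n z dz)) exprS -mulrA -IH.
have uv0 : u - v != 0 by rewrite subr_eq0.
have vu0 : v - u != 0 by rewrite subr_eq0 eq_sym.
have f1 z : disc z -> 1 - y1 z = (u - v) * (z - b) / ((b - v) * (z - u)).
  move=> dz; have zu := disc_neq_circle dz uu.
  by rewrite /y1 /X; field; rewrite zu bv.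
have f2 z : disc z -> 1 - y2 z = (v - u) * (1 - conjc b * z) / ((1 - conjc b * v) * (z - u)).
  move=> dz; have zu := disc_neq_circle dz uu.
  by rewrite /y2 /X; field; rewrite zu dv.
have y1_it n z : disc z -> y1 (iter n phi z) = q ^+ n * y1 z.
  by move=> dz; rewrite /y1 it_X// -mulrA.
have y2_it n z : disc z -> y2 (iter n phi z) = q ^+ n * y2 z.
  by move=> dz; rewrite /y2 it_X// -mulrA.
have e2_neq0 z : disc z -> e (y2 z) != 0.
  move=> dz; apply: (@qpochhammer_neq0 R e q (y2 z)) => [||||n] //.
  rewrite -y2_it// f2; last exact: it_disc.
  apply: mulf_neq0; last by rewrite invr_neq0// mulf_neq0// disc_neq_circle//; exact: it_disc.
  by rewrite mulf_neq0// one_sub_neq0// ltW// -discE; exact: it_disc.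
pose B z := e (y1 z) / e (y2 z).
pose c := - ((1 - conjc b * v) / (b - v)) / aut_lambda psi.
have c1 : normc c = 1.
  rewrite /c normcM normcV (normc_unit_circle (aut_lambda_circle psi)) invr1 mulr1.
  rewrite normcN normcM normcV.
  have v1 := normc_unit_circle vv.
  have : normc (1 - conjc b * v) ^+ 2 = normc (b - v) ^+ 2.
    by apply/eqP; rewrite -subr_eq0 [normc (b - v)]normcB moebius_identity v1 expr1n subrr mulr0.
  move=> /(pexpIrn (ltn0Sn 1)) ->; rewrite ?nnegrE ?normc_ge0//.
  by rewrite divff// gt_eqF// normc_gt0.
have BE z : disc z -> B z = c * psi z * B (phi z).
  move=> dz; have := y1_it 1%N _ dz; have := y2_it 1%N _ dz; rewrite /= expr1 => y2E y1E.
  have H1 : e (y1 z) = (1 - y1 z) * e (y1 (phi z)) by rewrite y1E -eq.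
  have H2 : e (y2 z) = (1 - y2 z) * e (y2 (phi z)) by rewrite y2E -eq.
  have zu := disc_neq_circle dz uu; have l0 := aut_lambda_neq0 psi.
  have zb : 1 - conjc b * z != 0 by rewrite one_sub_neq0// ltW// -discE.
  have -> : c * psi z = (1 - y1 z) / (1 - y2 z).
    rewrite (f1 _ dz) (f2 _ dz) /c /aut_fun -/b.
    move: (conjc b) (aut_lambda psi) dv zb l0 => b' l {}dv {}zb {}l0.
    by field; rewrite zb zu l0 bv dv vu0.
  by rewrite -[RHS]/(_ / _ * (e (y1 (phi z)) / e (y2 (phi z)))) mulf_div -H1 -H2.
exists B, c; split=> //.
- move=> z dz; have zu := disc_neq_circle dz uu.
  have hX : holo X z.
    apply: holoM; first by apply: holoB; [exact: holo_id|exact: holo_cst].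
    by apply: holoV => //; apply: holoB; [exact: holo_id|exact: holo_cst].
  have hy w : holo (fun z => e (X z * w)) z.
    apply: (@holo_comp _ (fun z => X z * w) e z).
      by apply: holoM; [exact: hX|exact: holo_cst].
    exact: (he (X z * w)).
  by apply: holoM; [exact: hy|apply: holoV; [exact: e2_neq0|exact: hy]].
- move=> z dz.
  have mono w : disc w -> normc (B w) <= normc (B (phi w)).
    move=> dw; rewrite BE// 2!normcM c1 mul1r ler_piMl ?normc_ge0// ltW// -discE.
    exact: aut_disc.
  have Bit n : normc (B z) <= normc (B (iter n phi z)).
    by elim: n => // n IH; apply: (le_trans IH); apply: mono; exact: it_disc.
  have [N1 H1] := eventually_close (y1 z) q1 (he 0) e0.
  have [N2 H2] := eventually_close (y2 z) q1 (he 0) e0.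
  have /normc_close1 /andP[_ h1] := H1 _ (leq_maxl N1 N2).
  have /normc_close1 /andP[h2 _] := H2 _ (leq_maxr N1 N2).
  apply: (le_trans (Bit (maxn N1 N2))); rewrite /B y1_it// y2_it// normcM normcV.
  by rewrite ler_pdivrMr; lra.
- have d0 : disc (0 : C) by rewrite discE normc0.
  have [N /(_ N (leqnn N)) /normc_close1 /andP[h _]] := eventually_close (y1 0) q1 (he 0) e0.
  exists (iter N phi 0); first exact: it_disc.
  apply: mulf_neq0; last by rewrite invr_neq0// e2_neq0//; exact: it_disc.
  by rewrite y1_it// -normc_gt0; lra.
Qed.

(** The weight is the principal root of k / (1 - conj(a) z)^2 with k = 1 - |a|^2. The
bound A comes from |1 - conj(a) z| <= 2. *)
Lemma weight_inverse_exists (p : R) (phi : disc_aut R) : 1 <= p ->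
  exists w A, forall z, disc z -> [/\ holo w z, normc (w z) <= A &
    principal_root p (conjc (aut_lambda phi) * 'D_1 (phi : C^o -> C^o) z) * w z = 1].
Proof.
move=> p1; pose a := aut_a phi; pose k : R := 1 - normc a ^+ 2.
have a1 : normc a < 1 by exact: aut_a_lt1.
have k0 : 0 < k by rewrite subr_gt0 expr_lt1 ?normc_ge0.
pose w z := cexp (- (((ln k)%:C - 2 * clog (1 - conjc a * z)) * (p^-1)%:C)).
exists w, (expR ((2 * ln 2 - ln k) / p)) => z dz.
have z1 : normc z < 1 by rewrite -discE.
have rz : 0 < complex.Re (1 - conjc a * z) by rewrite Re_one_sub_gt0// ltW.
split.
- have hl : holo (fun z => clog (1 - conjc a * z)) z.
    apply: (@holo_comp _ (fun z => 1 - conjc a * z) (@clog R) z); last exact: holo_clog.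
    by apply: holoB; [exact: holo_cst|apply: holoM; [exact: holo_cst|exact: holo_id]].
  apply: (@holo_comp _ (fun z => - (((ln k)%:C - 2 * clog (1 - conjc a * z)) * (p^-1)%:C))
    (@cexp R) z); last exact: holo_cexp.
  apply: derivableN; apply: holoM; last exact: holo_cst.
  by apply: holoB; [exact: holo_cst|apply: holoM; [exact: holo_cst|exact: hl]].
- rewrite normc_cexp ler_expR.
  set x := 1 - conjc a * z in rz *.
  have -> : complex.Re (- (((ln k)%:C - 2 * clog x) * p^-1%:C)) = (2 * ln (normc x) - ln k) / p.
    by rewrite /clog /=; ring.
  rewrite ler_wpM2r ?invr_ge0 ?(le_trans ler01)// lerD2r ler_wpM2l//.
  rewrite ler_ln ?posrE ?normc_gt0 ?Re_gt0_neq0//.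
  rewrite (le_trans (le_normcD _ _))// normc1 normcN normcM normc_conj.
  have := normc_ge0 a; have := normc_ge0 z; nra.
- rewrite aut_derive//.
  have -> : conjc (aut_lambda phi) * (aut_lambda phi * (1 - a * conjc a)
      / (1 - conjc a * z) ^+ 2) = k%:C / (1 - conjc a * z) ^+ 2.
    rewrite !mulrA [conjc _ * _]mulrC aut_lambda_unit mul1r /k rmorphB rmorph1 rmorphXn /=.
    by rewrite -sqr_normc.
  rewrite principal_root_div_sqr// -cexpD subrr /cexp /= expR0 /expi cos0 sin0.
  by rewrite (_ : 1 +i* 0 = 1)// mulr1.
Qed.

(** The quantification over u is what makes the induction work: B u = S (B u') with
u' = (c u w) o phi^(-1) again bounded and holomorphic, where w is the inverse of the
weight. *)
Lemma iter_range_multiple (p : R) (psi phi : disc_aut R) (B w : C -> C) (c : C) (b A : R) :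
  1 <= p ->
  (forall z, disc z -> holo B z) -> (forall z, disc z -> normc (B z) <= b) ->
  (forall z, disc z -> B z = c * psi z * B (phi z)) ->
  (forall z, disc z -> [/\ holo w z, normc (w z) <= A &
    principal_root p (conjc (aut_lambda phi) * 'D_1 (phi : C^o -> C^o) z) * w z = 1]) ->
  forall n u K, (forall z, disc z -> holo u z) -> (forall z, disc z -> normc (u z) <= K) ->
  iter_range p (fun f => mul_op psi (U_op p phi f)) n (fun z => B z * u z).
Proof.
move=> p1 hB Bb BE wE; have [phi' phiK] := aut_inv_exists phi.
elim=> [|n IH] u K hu uK.
  exists (fun z => B z * u z); last by [].
  apply: (@bounded_hardy_space _ p _ (b * K) p1) => z dz.
    exact: (holoM (hB _ dz) (hu _ dz)).
  by rewrite normcM; apply: ler_pM; rewrite ?normc_ge0//; [exact: Bb|exact: uK].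
pose u' z := c * (u (phi' z) * w (phi' z)).
have [||g gH gE] := IH u' (normc c * (K * A)).
- move=> z dz; have dz' := aut_disc phi' dz; have [hw _ _] := wE _ dz'.
  have hphi := aut_holo (phi := phi') dz.
  have h1 : holo (fun x => u (phi' x)) z := holo_comp hphi (hu _ dz').
  have h2 : holo (fun x => w (phi' x)) z := holo_comp hphi hw.
  have h3 : holo (fun x => u (phi' x) * w (phi' x)) z := holoM h1 h2.
  by apply: holoM; [exact: holo_cst|exact: h3].
- move=> z dz; have dz' := aut_disc phi' dz; have [_ wA _] := wE _ dz'.
  rewrite 2!normcM ler_wpM2l ?normc_ge0//.
  by apply: ler_pM; rewrite ?normc_ge0//; exact: uK.
exists g => // z dz; rewrite iterS /mul_op /U_op /mul_op /comp_op /=.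
have dz' := aut_disc phi dz; rewrite -(gE _ dz') /u' phiK// BE//.
have [_ _ ww] := wE _ dz.
set W := principal_root _ _ in ww *.
rewrite -[LHS]mulr1 -ww; ring.
Qed.

End Divisor.

Theorem proposition4 (R : realType) (p : R) (psi phi : disc_aut R)
    (p_ge1 : 1 <= p) (p_neq2 : p <> 2) (phi_hyp : hyperbolic phi) :
  ~ crownover p (fun f => mul_op psi (U_op p phi f)).
Proof.
have [B [c [hB Bb BE [z dz Bz]]]] := blaschke_hyperbolic psi phi_hyp.
have [w [A wE]] := weight_inverse_exists phi p_ge1.
move=> cr; move: Bz; apply/negP; rewrite negbK; apply/eqP.
suff : [set f : R[i] -> R[i] | forall z, disc z -> f z = 0] (fun z => B z * 1).
  by move=> /= /(_ _ dz); rewrite mulr1.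
rewrite -cr => n _.
apply: (@iter_range_multiple R p psi phi B w c 2 A p_ge1 hB Bb BE wE n (fun=> 1) 1) => y _.
  exact: holo_cst.
by rewrite normc1.
Qed.
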